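(* Let $\mathsf{JL}$ be one of the justification logics described in the context, and let $\mathcal{CS}$ be a finite constant specification for $\mathsf{JL}$. Then $\mathsf{JL}^e_{\mathcal{CS}}$-tableaux always terminate: for every $\mathsf{JL}$-formula $F$, every construction of a $\mathsf{JL}^e_{\mathcal{CS}}$-tableau for $F$ in which no rule application is repeated on a branch stops after finitely many rule applications. Therefore, the justification logic $\mathsf{JL}_{\mathcal{CS}}$ is decidable, i.e. there is an algorithm that decides, for a given $\mathsf{JL}$-formula $F$, whether $F$ is provable in $\mathsf{JL}_{\mathcal{CS}}$.
   Context: **Language.** Justification terms are built from justification variables $x,y,z,\dots$ and justification constants $a,b,c,\dots$ using binary operations $\cdot$, $+$ and unary operations $!$, $\bar{?}$, $?$. Formulas are given by $A ::= p \mid \bot \mid \neg A \mid A\to A \mid t:A$, where $p$ ranges over a countable set $\mathcal{P}$ of propositional variables and $t$ over terms. Subterms are defined as usual. A term $t$ occurs in a formula $F$ if $t$ is a subterm of some $r$ such that $r:B$ is a subformula of $F$ for some $B$. $Sub(A)$ is the set of subformulas: $Sub(p)=\{p\}$, $Sub(\bot)=\{\bot\}$, $Sub(\neg A)=\{\neg A\}\cup Sub(A)$, $Sub(A\to B)=\{A\to B\}\cup Sub(A)\cup Sub(B)$, $Sub(t:A)=\{t:A\}\cup Sub(A)$; for a set $S$ of formulas, $Sub(S)=\bigcup_{A\in S}Sub(A)$. **Justification logics.** The basic logic $\mathsf{J}$ has axiom schemes: (Taut) all propositional tautologies; (Sum) $s:A\to(s+t):A$ and $s:A\to(t+s):A$;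 (jK) $s:(A\to B)\to(t:A\to(s\cdot t):B)$. $\mathsf{JL}$ denotes any logic obtained from $\mathsf{J}$ by adding any combination (possibly none) of: (jT) $t:A\to A$; (jD) $t:\bot\to\bot$; (j4) $t:A\to\,!t:t:A$; (jB) $\neg A\to\bar{?}t:\neg t:A$; (j5) $\neg t:A\to\,?t:\neg t:A$. The language of $\mathsf{JL}$ includes only those term operations present in its axioms; its formulas are called $\mathsf{JL}$-formulas. **Constant specification and $\mathsf{JL}_{\mathcal{CS}}$.** A constant specification $\mathcal{CS}$ for $\mathsf{JL}$ is a set of formulas $c_{i_n}:c_{i_{n-1}}:\dots:c_{i_1}:A$, with $n\ge1$, the $c_{i_j}$ justification constants and $A$ an axiom instance of $\mathsf{JL}$, which is downward closed: if $c_{i_n}:c_{i_{n-1}}:\dots:c_{i_1}:A\in\mathcal{CS}$ with $n\ge2$, then $c_{i_{n-1}}:\dots:c_{i_1}:A\in\mathcal{CS}$. $\mathsf{JL}_{\mathcal{CS}}$ is the Hilbert system with the axioms of $\mathsf{JL}$, the rule Modus Ponens, and the rule (Iterated Axiom Necessitation restricted to $\mathcal{CS}$) that every formula of $\mathcal{CS}$ may be derived. **Tableaux.** $A$ is a $\mathcal{CS}$-subformula of $B$ if $A\in Sub(\{B\}\cup\mathcal{CS})$. Tableaux use $\mathsf{JL}$-formulas and evidential formulas $[t,A]$ and $\sim[t,A]$, where $t$ is a term and $A$ a $\mathsf{JL}$-formula. A $\mathsf{JL}^e_{\mathcal{CS}}$-tableau for a formula $F$ is a binary tree with root $\neg F$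 built by extending branches with the following rules (premises must be on the branch; ''$\mid$'' means the branch splits): - $(F\neg)$: from $\neg\neg A$ add $A$. $(F\to)$: from $\neg(A\to B)$ add $A$ and $\neg B$. $(T\to)$: from $A\to B$ split $\neg A\mid B$. - $(Te)$: from $t:A$ add $[t,A]$. $(Fe)$: from $\neg t:A$ add $\sim[t,A]$. - $(+_L)$: from $\sim[t+s,A]$ add $\sim[t,A]$. $(+_R)$: from $\sim[t+s,A]$ add $\sim[s,A]$. - $(\cdot)$: from $[s,A\to B]$ and $[t,A]$ add $[s\cdot t,B]$, provided $A\to B$ is a $\mathcal{CS}$-subformula of the root and $s\cdot t$ occurs in the root. - $(PB)$: split $A\mid\neg A$, provided $A$ is a $\mathcal{CS}$-subformula of the root. - $(PB_e)$: split $[t,A]\mid\sim[t,A]$, provided $A$ is a $\mathcal{CS}$-subformula of the root and $t$ occurs in the root. - If $\mathsf{JL}$ contains jT, $(e)$: from $[t,A]$ add $A$. If jD, $(e_\bot)$: from $[t,\bot]$ add $\bot$. If j4, $(!)$: from $\sim[!t,t:A]$ add $\sim[t,A]$. If jB, $(\bar{?})$: from $\sim[\bar{?}t,\neg t:A]$ add $A$. If j5, $(?)$: from $\sim[?t,\neg t:A]$ add $[t,A]$. A rule application is repeated on a branch if the same rule is applied more than once on that branch to the same premise formula(s) and with the same conclusion formula(s). A branch closes if it contains $A$ and $\neg A$ for some $\mathsf{JL}$-formula $A$; or $[t,A]$ and $\sim[t,A]$ for some $t,A$; or $\bot$; or $\neg c:F$ for some $c:F\in\mathcal{CS}$. A tableau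 closes if all its branches close. A $\mathsf{JL}^e_{\mathcal{CS}}$-tableau proof of $F$ is a closed $\mathsf{JL}^e_{\mathcal{CS}}$-tableau with root $\neg F$. *)

(* Defs.v *)
From Stdlib Require Import List Arith.
From Stdlib Require Cantor.
Import ListNotations.

(** * Language *)

(** One datatype carries the operations of every logic; [JLterm] and [JLform]
    below cut out the language of a given logic. *)
Inductive term : Type :=
| tvar (n : nat)
| tconst (n : nat)
| tapp (s t : term)     (* s . t *)
| tsum (s t : term)     (* s + t *)
| tbang (t : term)      (* ! t   *)
| twquest (t : term)    (* ?bar t, the operation of jB *)
| tquest (t : term).    (* ? t,    the operation of j5 *)

Inductive form : Type :=
| Var (n : nat)
| Bot
| Neg (A : form)
| Imp (A B : form)
| Just (t : term) (A : form).

Fixpoint subterms (t : term) : list term :=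
  t :: match t with
       | tvar _ | tconst _ => []
       | tapp r s | tsum r s => subterms r ++ subterms s
       | tbang s | twquest s | tquest s => subterms s
       end.

Fixpoint Sub (A : form) : list form :=
  A :: match A with
       | Var _ | Bot => []
       | Neg B | Just _ B => Sub B
       | Imp B C => Sub B ++ Sub C
       end.

Definition occurs (t : term) (F : form) : Prop :=
  exists r B, In (Just r B) (Sub F) /\ In t (subterms r).

(** * Justification logics *)

(** Which of the optional axiom schemes are added to J. *)
Record logic : Type := Logic { jT : bool; jD : bool; j4 : bool; jB : bool; j5 : bool }.

Fixpoint JLterm (L : logic) (t : term) : Prop :=
  match t with
  | tvar _ | tconst _ => True
  | tapp r s | tsum r s => JLterm L r /\ JLterm L s
  | tbang s => j4 L = true /\ JLterm L s
  | twquest s => jB L = true /\ JLterm L s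
  | tquest s => j5 L = true /\ JLterm L s
  end.

Fixpoint JLform (L : logic) (A : form) : Prop :=
  match A with
  | Var _ | Bot => True
  | Neg B => JLform L B
  | Imp B C => JLform L B /\ JLform L C
  | Just t B => JLterm L t /\ JLform L B
  end.

(** Formulas [t : A] are atoms for propositional logic. *)
Fixpoint truth (v : form -> bool) (A : form) : bool :=
  match A with
  | Bot => false
  | Neg B => negb (truth v B)
  | Imp B C => implb (truth v B) (truth v C)
  | Var _ | Just _ _ => v A
  end.

Definition tautology (A : form) : Prop := forall v, truth v A = true.

Inductive scheme (L : logic) : form -> Prop :=
| sc_taut A : tautology A -> scheme L A
| sc_suml s t A : scheme L (Imp (Just s A) (Just (tsum s t) A))
| sc_sumr s t A : scheme L (Imp (Just s A) (Just (tsum t s) A))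
| sc_jK s t A B :
    scheme L (Imp (Just s (Imp A B)) (Imp (Just t A) (Just (tapp s t) B)))
| sc_jT t A : jT L = true -> scheme L (Imp (Just t A) A)
| sc_jD t : jD L = true -> scheme L (Imp (Just t Bot) Bot)
| sc_j4 t A : j4 L = true ->
    scheme L (Imp (Just t A) (Just (tbang t) (Just t A)))
| sc_jB t A : jB L = true ->
    scheme L (Imp (Neg A) (Just (twquest t) (Neg (Just t A))))
| sc_j5 t A : j5 L = true ->
    scheme L (Imp (Neg (Just t A)) (Just (tquest t) (Neg (Just t A)))).

Definition axiom (L : logic) (A : form) : Prop := JLform L A /\ scheme L A.

(** [cprefix [c_n; ...; c_1] A] is [c_n : ... : c_1 : A]. *)
Fixpoint cprefix (cs : list nat) (A : form) : form :=
  match cs with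
  | [] => A
  | c :: cs' => Just (tconst c) (cprefix cs' A)
  end.

Record constant_specification (L : logic) (CS : form -> Prop) : Prop := {
  cs_shape : forall B, CS B ->
    exists cs A, cs <> [] /\ axiom L A /\ B = cprefix cs A;
  cs_downward : forall c cs A, cs <> [] -> axiom L A ->
    CS (cprefix (c :: cs) A) -> CS (cprefix cs A)
}.

Definition finite_set {T : Type} (S : T -> Prop) : Prop :=
  exists l : list T, forall x, S x <-> In x l.

Inductive provable (L : logic) (CS : form -> Prop) : form -> Prop :=
| pr_axiom A : axiom L A -> provable L CS A
| pr_mp A B : provable L CS (Imp A B) -> provable L CS A -> provable L CS B
| pr_ian A : CS A -> provable L CS A.

(** * Tableaux *)

Inductive tformula : Type :=
| Fm (A : form)
| Ev (t : term) (A : form)      (* [t, A]   *)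
| NEv (t : term) (A : form).    (* ~ [t, A] *)

Inductive rule_name : Type :=
| R_Fneg | R_Fimp | R_Timp | R_Te | R_Fe | R_plusL | R_plusR | R_app
| R_PB | R_PBe | R_e | R_ebot | R_bang | R_wquest | R_quest.

Inductive conclusion : Type :=
| Add (ns : list tformula)
| Split (n1 n2 : tformula).

Record application : Type :=
  App { app_rule : rule_name; app_prems : list tformula; app_concl : conclusion }.

(** [A] is a CS-subformula of [B]. *)
Definition CSsub (CS : form -> Prop) (A B : form) : Prop :=
  exists C, (C = B \/ CS C) /\ In A (Sub C).

Section Rules.
Variables (L : logic) (CS : form -> Prop) (root : form).

Inductive rule_instance : application -> Prop :=
| ri_Fneg A :
    rule_instance (App R_Fneg [Fm (Neg (Neg A))] (Add [Fm A]))
| ri_Fimp A B :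
    rule_instance (App R_Fimp [Fm (Neg (Imp A B))] (Add [Fm A; Fm (Neg B)]))
| ri_Timp A B :
    rule_instance (App R_Timp [Fm (Imp A B)] (Split (Fm (Neg A)) (Fm B)))
| ri_Te t A :
    rule_instance (App R_Te [Fm (Just t A)] (Add [Ev t A]))
| ri_Fe t A :
    rule_instance (App R_Fe [Fm (Neg (Just t A))] (Add [NEv t A]))
| ri_plusL s t A :
    rule_instance (App R_plusL [NEv (tsum t s) A] (Add [NEv t A]))
| ri_plusR s t A :
    rule_instance (App R_plusR [NEv (tsum t s) A] (Add [NEv s A]))
| ri_app s t A B :
    CSsub CS (Imp A B) root -> occurs (tapp s t) root ->
    rule_instance (App R_app [Ev s (Imp A B); Ev t A] (Add [Ev (tapp s t) B]))
| ri_PB A :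
    CSsub CS A root ->
    rule_instance (App R_PB [] (Split (Fm A) (Fm (Neg A))))
| ri_PBe t A :
    CSsub CS A root -> occurs t root ->
    rule_instance (App R_PBe [] (Split (Ev t A) (NEv t A)))
| ri_e t A : jT L = true ->
    rule_instance (App R_e [Ev t A] (Add [Fm A]))
| ri_ebot t : jD L = true ->
    rule_instance (App R_ebot [Ev t Bot] (Add [Fm Bot]))
| ri_bang t A : j4 L = true ->
    rule_instance (App R_bang [NEv (tbang t) (Just t A)] (Add [NEv t A]))
| ri_wquest t A : jB L = true ->
    rule_instance (App R_wquest [NEv (twquest t) (Neg (Just t A))] (Add [Fm A]))
| ri_quest t A : j5 L = true ->
    rule_instance (App R_quest [NEv (tquest t) (Neg (Just t A))] (Add [Ev t A])).

(** A tableau below its root, recorded as the tree of the rule applications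
    made; [Leaf] is the current end of a branch. *)
Inductive tableau : Type :=
| Leaf
| Linear (r : rule_name) (prems ns : list tformula) (T : tableau)
| Branch (r : rule_name) (prems : list tformula) (n1 n2 : tformula)
         (T1 T2 : tableau).

(** [extends G H T T']: [T'] results from [T] by one non-repeated rule
    application at the end of one branch, when [T] hangs below a path carrying
    the formulas [G] on which the applications [H] were made. *)
Inductive extends (G : list tformula) (H : list application) :
  tableau -> tableau -> Prop :=
| ext_linear r prems ns :
    rule_instance (App r prems (Add ns)) -> incl prems G ->
    ~ In (App r prems (Add ns)) H ->
    extends G H Leaf (Linear r prems ns Leaf)
| ext_branch r prems n1 n2 :
    rule_instance (App r prems (Split n1 n2)) -> incl prems G ->
    ~ In (App r prems (Split n1 n2)) H ->
    extends G H Leaf (Branch r prems n1 n2 Leaf Leaf)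
| ext_below r prems ns T T' :
    extends (ns ++ G) (App r prems (Add ns) :: H) T T' ->
    extends G H (Linear r prems ns T) (Linear r prems ns T')
| ext_left r prems n1 n2 T1 T1' T2 :
    extends (n1 :: G) (App r prems (Split n1 n2) :: H) T1 T1' ->
    extends G H (Branch r prems n1 n2 T1 T2) (Branch r prems n1 n2 T1' T2)
| ext_right r prems n1 n2 T1 T2 T2' :
    extends (n2 :: G) (App r prems (Split n1 n2) :: H) T2 T2' ->
    extends G H (Branch r prems n1 n2 T1 T2) (Branch r prems n1 n2 T1 T2').

Definition tableau_step : tableau -> tableau -> Prop := extends [Fm root] [].

End Rules.

(** Every step-by-step construction of a tableau for [F] (root [Neg F]) gets
    stuck: no sequence of tableaux can go on by rule applications forever. *)
Definition tableaux_terminate (L : logic) (CS : form -> Prop) (F : form) : Prop :=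
  forall T : nat -> tableau, T 0 = Leaf ->
    exists n, ~ tableau_step L CS (Neg F) (T n) (T (S n)).

(** * Algorithms *)

(** Decidability is stated through partial recursive functions: a mere
    [form -> bool] would exist for every set of formulas by classical logic.
    Functions are unary on [nat]; several arguments are passed as one by means
    of Cantor's pairing bijection. *)
Notation pair a b := (Cantor.to_nat (a, b)).

Inductive prog : Type :=
| p_zero
| p_succ
| p_left
| p_right
| p_pair (f g : prog)
| p_comp (f g : prog)
| p_prec (f g : prog)   (* h(a,0) = f(a);  h(a,k+1) = g(a,(k,h(a,k))) *)
| p_find (f : prog).    (* unbounded search: least m with f(n,m) = 0 *)

(** Graph of the partial function computed by a program. *)
Fixpoint computes (p : prog) (n m : nat) : Prop :=
  match p with
  | p_zero => m = 0
  | p_succ => m = S n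
  | p_left => m = fst (Cantor.of_nat n)
  | p_right => m = snd (Cantor.of_nat n)
  | p_pair f g => exists a b, computes f n a /\ computes g n b /\ m = pair a b
  | p_comp f g => exists k, computes g n k /\ computes f k m
  | p_prec f g =>
      let a := fst (Cantor.of_nat n) in
      (fix rec (k : nat) (m : nat) : Prop :=
         match k with
         | 0 => computes f a m
         | S k' => exists r, rec k' r /\ computes g (pair a (pair k' r)) m
         end) (snd (Cantor.of_nat n)) m
  | p_find f =>
      computes f (pair n m) 0 /\
      forall i, i < m -> exists k, computes f (pair n i) (S k)
  end.

Lemma computes_functional p :
  forall n m m', computes p n m -> computes p n m' -> m = m'.
Proof.
  induction p as [| | | |f IHf g IHg|f IHf g IHg|f IHf g IHg|f IHf];
    intros n m m' H H'; cbn [computes] in H, H'; try congruence.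
  - destruct H as (a & b & Ha & Hb & ->), H' as (a' & b' & Ha' & Hb' & ->).
    now rewrite (IHf _ _ _ Ha Ha'), (IHg _ _ _ Hb Hb').
  - destruct H as (k & Hg & Hf), H' as (k' & Hg' & Hf').
    rewrite (IHg _ _ _ Hg Hg') in Hf. exact (IHf _ _ _ Hf Hf').
  - cbv zeta in H, H'. revert m m' H H'.
    induction (snd (Cantor.of_nat n)) as [|k IHk]; intros m m' H H'.
    + exact (IHf _ _ _ H H').
    + destruct H as (r & Hr & Hm), H' as (r' & Hr' & Hm').
      rewrite (IHk _ _ Hr Hr') in Hm. exact (IHg _ _ _ Hm Hm').
  - destruct H as [H0 Hlt], H' as [H0' Hlt'].
    destruct (Nat.lt_trichotomy m m') as [h|[h|h]]; [|exact h|].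
    + destruct (Hlt' _ h) as [k Hk]. discriminate (IHf _ _ _ H0 Hk).
    + destruct (Hlt _ h) as [k Hk]. discriminate (IHf _ _ _ H0' Hk).
Qed.

(** Goedel numbers. *)
Fixpoint term_code (t : term) : nat :=
  match t with
  | tvar n => pair 0 n
  | tconst n => pair 1 n
  | tapp r s => pair 2 (pair (term_code r) (term_code s))
  | tsum r s => pair 3 (pair (term_code r) (term_code s))
  | tbang s => pair 4 (term_code s)
  | twquest s => pair 5 (term_code s)
  | tquest s => pair 6 (term_code s)
  end.

Fixpoint form_code (A : form) : nat :=
  match A with
  | Var n => pair 0 n
  | Bot => pair 1 0
  | Neg B => pair 2 (form_code B)
  | Imp B C => pair 3 (pair (form_code B) (form_code C))
  | Just t B => pair 4 (pair (term_code t) (form_code B))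
  end.

(** Some program halts on the code of every formula of [D], with output 1 on
    those that satisfy [P] and output 0 on the others. *)
Definition decidable_on (D P : form -> Prop) : Prop :=
  exists p : prog, forall F, D F ->
    (computes p (form_code F) 1 /\ P F) \/ (computes p (form_code F) 0 /\ ~ P F).

(* Main.v *)
(** Termination: along a branch only analytic formulas occur, so that finitely
    many rule applications are possible; as none is repeated, branches are bounded,
    and since a step only replaces a leaf, a tableau is accessible as soon as its
    subtrees are.

    Decidability: the tableaux are not used for it, because they are not complete
    (with jD, [x:(p -> false) -> y:p -> false] is provable, but the term [x.y] is
    not available to a tableau). Instead, [F] is provable iff it follows
    propositionally from the members of CS and the finitely many axiom instances
    whose codes are below a computable bound. If it does not follow, a valuation
    [w] of the small formulas satisfies these instances and refutes [F], and it
    extends to a valuation satisfying all axioms. Let [X] be the formulas with codes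
    at most [M], where [M] exceeds the codes of [F] and of CS. For formulas in [X],
    the evidence is given by [w] for small terms and by closing under [.] and [+]
    for the other terms, which is harmless because no [t:A] in [X] mentions the
    latter. For formulas outside [X], evidence is only put where j4, jB and j5
    demand it, by recursion on the formula. This adds no evidence for implications,
    hence jK never leaves [X]. For jD alone one must know that closing under [.]
    yields no evidence for [Bot]: the sets of formulas of [X] that have evidence
    from terms of increasing size stabilise after at most [M + 1] steps. *)

From Stdlib Require Import List Arith Lia Classical ClassicalEpsilon.
From Stdlib Require Cantor.
Require Import Defs.
Import ListNotations.

Local Opaque Cantor.to_nat Cantor.of_nat.

(** * Termination *)

Lemma Sub_refl A : In A (Sub A).
Proof. destruct A; now left. Qed.

Lemma Sub_trans A B C : In A (Sub B) -> In B (Sub C) -> In A (Sub C).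
Proof.
  intros HA; induction C as [n| |C IH|C1 IH1 C2 IH2|t C IH];
    (intros [->|HB]; [exact HA|]); try contradiction; right; auto.
  apply in_app_iff in HB; apply in_app_iff; tauto.
Qed.

Lemma subterms_refl t : In t (subterms t).
Proof. destruct t; now left. Qed.

Lemma subterms_trans r s t :
  In r (subterms s) -> In s (subterms t) -> In r (subterms t).
Proof.
  intros Hr; induction t; (intros [->|Hs]; [exact Hr|]); try contradiction;
    right; auto; apply in_app_iff in Hs; apply in_app_iff; tauto.
Qed.

Section Termination.
Variables (L : logic) (CS : form -> Prop) (root : form) (lCS : list form).
Hypothesis lCS_spec : forall A, CS A <-> In A lCS.

Definition forms : list form := flat_map Sub (root :: lCS).

(** [tvar 0] only keeps the list nonempty, for [applications] below. *)
Definition terms : list term :=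
  tvar 0 :: flat_map (fun A => match A with Just t _ => subterms t | _ => [] end) forms.

Lemma forms_CSsub A : CSsub CS A root <-> In A forms.
Proof.
  unfold CSsub, forms; rewrite in_flat_map; split; intros (C & HC & HA);
    exists C; split; trivial.
  - destruct HC as [->|HC]; [now left|right; now apply lCS_spec].
  - destruct HC as [<-|HC]; [now left|right; now apply lCS_spec].
Qed.

Lemma forms_Sub A B : In A (Sub B) -> In B forms -> In A forms.
Proof.
  unfold forms; rewrite !in_flat_map; intros HA (C & HC & HB).
  exists C; split; trivial; now apply Sub_trans with B.
Qed.

Lemma terms_subterms s t : In s (subterms t) -> In t terms -> In s terms.
Proof.
  intros Hs [<-|Ht].
  - destruct Hs as [<-|[]]; now left.
  - right. apply in_flat_map in Ht as (A & HA & Ht). apply in_flat_map.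
    exists A; split; trivial. destruct A; try contradiction.
    now apply subterms_trans with t.
Qed.

Lemma forms_Just t A : In (Just t A) forms -> In t terms /\ In A forms.
Proof.
  intros H; split.
  - right; apply in_flat_map; exists (Just t A); split; trivial; apply subterms_refl.
  - apply forms_Sub with (2 := H); right; apply Sub_refl.
Qed.

Lemma forms_Neg A : In (Neg A) forms -> In A forms.
Proof. apply forms_Sub; right; apply Sub_refl. Qed.

Lemma forms_Imp A B : In (Imp A B) forms -> In A forms /\ In B forms.
Proof.
  intros H; split; apply forms_Sub with (2 := H); right; apply in_app_iff;
    [left|right]; apply Sub_refl.
Qed.

Lemma forms_root : In root forms.
Proof. apply in_flat_map; exists root; split; [now left|apply Sub_refl]. Qed.

Lemma terms_occurs t : occurs t root -> In t terms.
Proof.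
  intros (r & B & HB & Ht). apply terms_subterms with r; trivial.
  apply (forms_Just r B), forms_Sub with (1 := HB), forms_root.
Qed.

Definition analytic (x : tformula) : Prop :=
  match x with
  | Fm A => In A forms \/ exists B, A = Neg B /\ In B forms
  | Ev t A | NEv t A => In t terms /\ In A forms
  end.

(** Side conditions are dropped: a finite superset of the possible applications is enough to bound
    branches. *)
Definition instances (s t : term) (A B : form) : list application :=
  [App R_Fneg [Fm (Neg (Neg A))] (Add [Fm A]);
   App R_Fimp [Fm (Neg (Imp A B))] (Add [Fm A; Fm (Neg B)]);
   App R_Timp [Fm (Imp A B)] (Split (Fm (Neg A)) (Fm B));
   App R_Te [Fm (Just t A)] (Add [Ev t A]);
   App R_Fe [Fm (Neg (Just t A))] (Add [NEv t A]);
   App R_plusL [NEv (tsum t s) A] (Add [NEv t A]);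
   App R_plusR [NEv (tsum t s) A] (Add [NEv s A]);
   App R_app [Ev s (Imp A B); Ev t A] (Add [Ev (tapp s t) B]);
   App R_PB [] (Split (Fm A) (Fm (Neg A)));
   App R_PBe [] (Split (Ev t A) (NEv t A));
   App R_e [Ev t A] (Add [Fm A]);
   App R_ebot [Ev t Bot] (Add [Fm Bot]);
   App R_bang [NEv (tbang t) (Just t A)] (Add [NEv t A]);
   App R_wquest [NEv (twquest t) (Neg (Just t A))] (Add [Fm A]);
   App R_quest [NEv (tquest t) (Neg (Just t A))] (Add [Ev t A])].

Definition applications : list application :=
  flat_map (fun s => flat_map (fun t => flat_map (fun A => flat_map (fun B =>
    instances s t A B)
  forms) forms) terms) terms.

Lemma in_applications x s t A B :
  In s terms -> In t terms -> In A forms -> In B forms ->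
  In x (instances s t A B) ->
  In x applications.
Proof.
  intros Hs Ht HA HB Hx.
  apply in_flat_map; exists s; split; trivial.
  apply in_flat_map; exists t; split; trivial.
  apply in_flat_map; exists A; split; trivial.
  apply in_flat_map; exists B; split; trivial.
Qed.

Definition concl_formulas (c : conclusion) : list tformula :=
  match c with Add ns => ns | Split n1 n2 => [n1; n2] end.

Lemma analytic_Neg A : analytic (Fm (Neg A)) -> In A forms.
Proof.
  intros [H|(B & [= <-] & H)]; trivial; now apply forms_Neg.
Qed.

(** Conclusions consist of subterms and subformulas of the premises, up to one negation; for
    [R_app], [R_PB] and [R_PBe] the side conditions keep the new material in [terms] and [forms]. *)
Lemma rule_instance_analytic x :
  rule_instance L CS root x -> Forall analytic (app_prems x) ->
  In x applications /\ Forall analytic (concl_formulas (app_concl x)).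
Proof.
  assert (H0 : In (tvar 0) terms) by now left.
  assert (Hsub : forall s t, In t terms -> In s (subterms t) -> In s terms)
    by (intros; eauto using terms_subterms).
  pose proof forms_root as Hr.
  assert (Hdec : forall A, In A forms ->
    match A with Neg B => In B forms | Imp B C => In B forms /\ In C forms
    | Just t B => In t terms /\ In B forms | _ => True end).
  { intros [] H; auto using forms_Neg, forms_Imp, forms_Just. }
  intros [A|A B|A B|t A|t A|s t A|s t A|s t A B HC Ho|A HC|t A HC Ho|t A HL|t HL|t A HL
    |t A HL|t A HL] Hp; cbn in Hp;
    repeat match goal with
      | H : Forall _ (_ :: _) |- _ => inversion_clear H
      | H : Forall _ [] |- _ => clear H
      | H : CSsub _ _ _ |- _ => apply forms_CSsub in H
      | H : occurs _ _ |- _ => apply terms_occurs in H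
      | H : analytic (Fm (Neg _)) |- _ => apply analytic_Neg in H
      | H : analytic (Fm _) |- _ => destruct H as [H|(? & [=] & H)]
      | H : analytic _ |- _ => destruct H
      | H : In (Neg _) forms |- _ => apply Hdec in H
      | H : In (Imp _ _) forms |- _ => apply Hdec in H as []
      | H : In (Just _ _) forms |- _ => apply Hdec in H as []
      end;
    repeat match goal with
      | H : In (tapp ?s ?t) terms |- _ =>
          assert (In s terms /\ In t terms) as [] by
            (split; apply (Hsub _ _ H); right; apply in_app_iff;
             auto using subterms_refl); revert H
      | H : In (tsum ?s ?t) terms |- _ =>
          assert (In s terms /\ In t terms) as [] by
            (split; apply (Hsub _ _ H); right; apply in_app_iff;
             auto using subterms_refl); revert H
      end; intros.
  all: split; [|cbn [concl_formulas app_concl]; repeat apply Forall_cons;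
      try apply Forall_nil; cbn [analytic]; eauto 6].
  (* The alternatives match the parameters of the rule with those of [instances]; [tvar 0] and
     [root] fill the slots that the rule leaves open. *)
  all: first
    [ now apply (in_applications _ s t A B); cbn; tauto
    | now apply (in_applications _ s t A A); cbn; tauto
    | now apply (in_applications _ t s A A); cbn; tauto
    | now apply (in_applications _ t t A A); cbn; tauto
    | now apply (in_applications _ (tvar 0) (tvar 0) A B); cbn; tauto
    | now apply (in_applications _ (tvar 0) (tvar 0) A A); cbn; tauto
    | now apply (in_applications _ t t root root); cbn; tauto ].
Qed.

(** * Well-foundedness of tableau extension *)

Lemma Acc_Linear G H r prems ns T :
  Acc (fun T' T => extends L CS root (ns ++ G) (App r prems (Add ns) :: H) T T') T ->
  Acc (fun T' T => extends L CS root G H T T') (Linear r prems ns T).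
Proof.
  induction 1 as [T _ IH]. constructor; intros T' HT'.
  inversion HT'; subst; auto.
Qed.

(** A step moves exactly one of the two subtrees, so nested accessibility inductions work as for a
    product of well-founded relations. *)
Lemma Acc_Branch G H r prems n1 n2 T1 T2 :
  Acc (fun T' T =>
    extends L CS root (n1 :: G) (App r prems (Split n1 n2) :: H) T T') T1 ->
  Acc (fun T' T =>
    extends L CS root (n2 :: G) (App r prems (Split n1 n2) :: H) T T') T2 ->
  Acc (fun T' T => extends L CS root G H T T') (Branch r prems n1 n2 T1 T2).
Proof.
  intros H1; revert T2; induction H1 as [T1 _ IH1].
  intros T2 H2; induction H2 as [T2 H2 IH2].
  constructor; intros T' HT'; inversion HT'; subst; auto.
  apply IH1; trivial; now constructor.
Qed.

(** [k] exceeds the number of applications still possible on the branch: [H] is duplicate-free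
    inside a finite list, and every application lengthens it. *)
Lemma Acc_Leaf k : forall G H,
  Forall analytic G -> NoDup H -> incl H applications ->
  length applications < length H + k ->
  Acc (fun T' T => extends L CS root G H T T') Leaf.
Proof.
  induction k as [|k IH]; intros G H HG HH Hincl Hk.
  { pose proof (NoDup_incl_length HH Hincl); lia. }
  assert (step : forall r prems c, rule_instance L CS root (App r prems c) ->
    incl prems G -> ~ In (App r prems c) H ->
    Forall analytic (concl_formulas c) /\
    forall ns, Forall analytic ns ->
    Acc (fun T' T => extends L CS root (ns ++ G) (App r prems c :: H) T T') Leaf).
  { intros r prems c Hr Hp Hn.
    destruct (rule_instance_analytic _ Hr) as [Hin Hc].
    { now apply incl_Forall with G. }
    split; trivial. intros ns Hns. apply IH; cbn [length].
    - now apply Forall_app.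
    - now constructor.
    - intros x [<-|Hx]; auto.
    - lia. }
  constructor; intros T' HT'.
  inversion HT' as [r prems ns Hr Hp Hn|r prems n1 n2 Hr Hp Hn| | |]; subst;
    destruct (step _ _ _ Hr Hp Hn) as [Hc HA].
  - now apply Acc_Linear, HA.
  - inversion_clear Hc as [|? ? H1 Hc']; inversion_clear Hc' as [|? ? H2 _].
    apply Acc_Branch; [apply (HA [n1])|apply (HA [n2])]; auto.
Qed.

End Termination.

Lemma tableaux_always_terminate L CS F : finite_set CS -> tableaux_terminate L CS F.
Proof.
  intros [l Hl] T HT. apply NNPP; intros Hn.
  assert (Hstep : forall n, tableau_step L CS (Neg F) (T n) (T (S n))).
  { intros n; apply NNPP; eauto. }
  assert (HA : Acc (fun T' T => tableau_step L CS (Neg F) T T') (T 0)).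
  { rewrite HT.
    apply (Acc_Leaf L CS (Neg F) l Hl (S (length (applications (Neg F) l)))).
    - apply Forall_cons; [left; apply forms_root|apply Forall_nil].
    - constructor.
    - intros x [].
    - cbn [length]; lia. }
  remember (T 0) as U eqn:HU. clear Hn HT.
  (* The induction on accessibility needs a claim about all members of the sequence, not only about
     [T 0]. *)
  enough (forall n, T n <> U) by now apply (H 0).
  clear HU. induction HA as [U _ IH]; intros n <-. now apply (IH _ (Hstep n) (S n)).
Qed.

(** * Recursive functions and predicates *)

Definition lft (n : nat) : nat := fst (Cantor.of_nat n).
Definition rgt (n : nat) : nat := snd (Cantor.of_nat n).

Lemma lft_pair a b : lft (pair a b) = a.
Proof. unfold lft; now rewrite Cantor.cancel_of_to. Qed.

Lemma rgt_pair a b : rgt (pair a b) = b.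
Proof. unfold rgt; now rewrite Cantor.cancel_of_to. Qed.

Lemma pair_lft_rgt n : pair (lft n) (rgt n) = n.
Proof. unfold lft, rgt; rewrite <- surjective_pairing; apply Cantor.cancel_to_of. Qed.

Definition computable (f : nat -> nat) : Prop :=
  exists p, forall n, computes p n (f n).

Lemma computable_ext f g : (forall n, f n = g n) -> computable f -> computable g.
Proof. intros H [p Hp]; exists p; intros n; rewrite <- H; apply Hp. Qed.

Lemma computable_comp f g :
  computable f -> computable g -> computable (fun n => f (g n)).
Proof. intros [p Hp] [r Hr]; exists (p_comp p r); intros n; exists (g n); auto. Qed.

Lemma computable_pair f g :
  computable f -> computable g -> computable (fun n => pair (f n) (g n)).
Proof.
  intros [p Hp] [r Hr]; exists (p_pair p r); intros n.
  exists (f n), (g n); auto.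
Qed.

Lemma computable_lft f : computable f -> computable (fun n => lft (f n)).
Proof. apply (computable_comp lft); exists p_left; reflexivity. Qed.

Lemma computable_rgt f : computable f -> computable (fun n => rgt (f n)).
Proof. apply (computable_comp rgt); exists p_right; reflexivity. Qed.

Lemma computable_succ f : computable f -> computable (fun n => S (f n)).
Proof. apply (computable_comp S); exists p_succ; reflexivity. Qed.

(** [prog] has no identity instruction; pairing the two projections of [n] rebuilds it. *)
Lemma computable_id : computable (fun n => n).
Proof.
  apply (computable_ext (fun n => pair (lft n) (rgt n)) _ pair_lft_rgt).
  apply computable_pair; [exists p_left|exists p_right]; reflexivity.
Qed.

Lemma computable_const c : computable (fun _ => c).
Proof.
  induction c as [|c IH]; [exists p_zero; reflexivity|now apply computable_succ].
Qed.

Lemma computable_add_const c f : computable f -> computable (fun n => f n + c).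
Proof.
  intros Hf; induction c as [|c IH].
  - apply computable_ext with f; trivial; intros; lia.
  - apply computable_ext with (fun n => S (f n + c)); [intros; lia|].
    now apply computable_succ.
Qed.

(** [p_prec] carries one parameter, so the whole input [n] is stored there, paired with the
    recursion depth [h n]. *)
Lemma computable_rec f g h :
  computable f -> computable h ->
  computable (fun x => g (lft x) (lft (rgt x)) (rgt (rgt x))) ->
  computable (fun n => nat_rect (fun _ => nat) (f n) (g n) (h n)).
Proof.
  intros [p Hp] Hh [r Hr].
  apply computable_ext with
    (fun n => (fun x => nat_rect (fun _ => nat) (f (lft x)) (g (lft x)) (rgt x))
                (pair n (h n))).
  { intros n; now rewrite lft_pair, rgt_pair. }
  apply (computable_comp
    (fun x => nat_rect (fun _ => nat) (f (lft x)) (g (lft x)) (rgt x))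
    (fun n => pair n (h n))); [|auto using computable_pair, computable_id].
  exists (p_prec p r); intros n; cbn [computes]; cbv zeta.
  fold (lft n) (rgt n). induction (rgt n) as [|k IH]; [apply Hp|].
  exists (nat_rect (fun _ => nat) (f (lft n)) (g (lft n)) k); split; [exact IH|].
  pose proof (Hr (pair (lft n)
    (pair k (nat_rect (fun _ => nat) (f (lft n)) (g (lft n)) k)))) as H.
  rewrite lft_pair, !rgt_pair, lft_pair in H. exact H.
Qed.

Lemma computable_if f g h : computable f -> computable g -> computable h ->
  computable (fun n => match f n with 0 => h n | S _ => g n end).
Proof.
  intros Hf Hg Hh.
  apply computable_ext with
    (fun n => nat_rect (fun _ => nat) (h n) ((fun n _ _ => g n) n) (f n)).
  { intros n; now destruct (f n). }
  apply computable_rec; trivial.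
  now apply computable_comp, computable_lft, computable_id.
Qed.

Definition recursive (P : nat -> Prop) : Prop :=
  exists f, computable f /\ forall n, f n <> 0 <-> P n.

Lemma recursive_ext P Q : (forall n, P n <-> Q n) -> recursive P -> recursive Q.
Proof. intros H (f & Hf & Hs); exists f; split; trivial; firstorder. Qed.

Lemma recursive_decides P : recursive P ->
  exists p, forall n, (computes p n 1 /\ P n) \/ (computes p n 0 /\ ~ P n).
Proof.
  intros (f & Hf & Hs).
  destruct (computable_if f _ _ Hf (computable_const 1) (computable_const 0)) as [p Hp].
  exists p; intros n; specialize (Hp n); specialize (Hs n); destruct (f n).
  - right; split; trivial; intros HP; now apply Hs in HP.
  - left; split; trivial; now apply Hs.
Qed.

Lemma recursive_nonzero f : computable f -> recursive (fun n => f n <> 0).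
Proof. intros Hf; now exists f. Qed.

(** The truth value is fixed, so one of two constant functions is right, whichever it is. This
    covers conditions such as [j4 L = true]. *)
Lemma recursive_const (P : Prop) : recursive (fun _ => P).
Proof.
  destruct (classic P); [exists (fun _ => 1)|exists (fun _ => 0)];
    (split; [apply computable_const|intros; split; intros; trivial; lia || contradiction]).
Qed.

Lemma recursive_impl P Q :
  recursive P -> recursive Q -> recursive (fun n => P n -> Q n).
Proof.
  intros (f & Hf & Hfs) (g & Hg & Hgs).
  exists (fun n => match f n with 0 => 1 | S _ => g n end); split.
  - now apply computable_if, computable_const.
  - intros n; rewrite <- Hfs, <- Hgs; destruct (f n); split; intros; try lia; auto.
Qed.

Lemma recursive_and P Q :
  recursive P -> recursive Q -> recursive (fun n => P n /\ Q n).
Proof.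
  intros (f & Hf & Hfs) (g & Hg & Hgs).
  exists (fun n => match f n with 0 => 0 | S _ => g n end); split.
  - now apply computable_if, computable_const.
  - intros n; rewrite <- Hfs, <- Hgs; destruct (f n); split; intros; try lia; auto.
Qed.

Lemma recursive_not P : recursive P -> recursive (fun n => ~ P n).
Proof. intros HP; apply recursive_impl; trivial; apply recursive_const. Qed.

Lemma recursive_iff P Q :
  recursive P -> recursive Q -> recursive (fun n => P n <-> Q n).
Proof. intros; now apply recursive_and; apply recursive_impl. Qed.

(** The loop starts from 1, drops to 0 at the first failing [m] and stays there. *)
Lemma recursive_forall_lt P h : computable h ->
  recursive (fun x => P (lft x) (rgt x)) ->
  recursive (fun n => forall m, m < h n -> P n m).
Proof.
  intros Hh (f & Hf & Hs).
  exists (fun n => nat_rect (fun _ => nat) 1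
    ((fun n k r => match f (pair n k) with 0 => 0 | S _ => r end) n) (h n)); split.
  - apply computable_rec; auto using computable_const.
    apply computable_if; auto using computable_const, computable_rgt, computable_id.
    apply computable_comp; trivial.
    auto using computable_pair, computable_lft, computable_rgt, computable_id.
  - intros n; induction (h n) as [|k IH]; cbn [nat_rect].
    + split; intros; lia.
    + specialize (Hs (pair n k)); rewrite lft_pair, rgt_pair in Hs.
      destruct (f (pair n k)); split.
      * lia.
      * intros H. exfalso. now apply Hs; [apply H; lia|].
      * intros H m Hm. apply Nat.lt_succ_r, Nat.lt_eq_cases in Hm as [Hm| ->].
        -- now apply IH.
        -- now apply Hs.
      * intros H; apply IH; auto.
Qed.

(** [entry c i] reads digit [i] of the certificate
    [c = pair d_0 (pair d_1 (pair d_2 ...))] as a truth value. *)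
Definition entry (c i : nat) : Prop :=
  lft (nat_rect (fun _ => nat) c (fun _ => rgt) i) <> 0.

Lemma recursive_entry f g : computable f -> computable g ->
  recursive (fun n => entry (f n) (g n)).
Proof.
  intros Hf Hg; apply recursive_nonzero, computable_lft.
  apply (computable_rec f (fun _ _ => rgt)); trivial.
  auto using computable_rgt, computable_id.
Qed.

(** Strict bound for certificates with [k] digits in {0, 1}: a new leading digit turns [c < r] into
    [pair d c <= pair 1 r]. *)
Definition certificate_bound (k : nat) : nat :=
  nat_rect (fun _ => nat) 1 (fun _ r => S (pair 1 r)) k.

Lemma pair_le a b c d : a <= c -> b <= d -> pair a b <= pair c d.
Proof.
  intros Ha Hb; pose proof (Cantor.to_nat_spec a b); pose proof (Cantor.to_nat_spec c d).
  nia.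
Qed.

(** Thanks to this, a bounded quantifier over numbers ranges over all truth assignments to the first
    [k] indices. *)
Lemma certificate_exists k : forall P : nat -> Prop,
  exists c, c < certificate_bound k /\ forall i, i < k -> entry c i <-> P i.
Proof.
  induction k as [|k IH]; intros P; cbn.
  { exists 0; split; [lia|]; intros; lia. }
  destruct (IH (fun i => P (S i))) as (c & Hc & Hs).
  assert (Hd : exists d, d <= 1 /\ (d <> 0 <-> P 0)).
  { destruct (classic (P 0)); [exists 1|exists 0]; split; try lia; split; trivial;
      lia || contradiction. }
  destruct Hd as (d & Hd & HP). exists (pair d c); split.
  - apply Nat.lt_succ_r, pair_le; fold (certificate_bound k); lia.
  - intros [|i] Hi; unfold entry.
    + cbn; now rewrite lft_pair.
    + rewrite nat_rect_succ_r, rgt_pair. apply Hs; lia.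
Qed.

(** * Injectivity of the Goedel numbering *)

Lemma pair_inj a b c d : pair a b = pair c d -> a = c /\ b = d.
Proof.
  intros H; split; [rewrite <- (lft_pair a b), <- (lft_pair c d)
    |rewrite <- (rgt_pair a b), <- (rgt_pair c d)]; now rewrite H.
Qed.

Lemma term_code_inj s t : term_code s = term_code t -> s = t.
Proof.
  revert t; induction s; intros [] H; cbn in H; apply pair_inj in H as [H0 H];
    try discriminate; try apply pair_inj in H as [H H']; f_equal; auto.
Qed.

Lemma form_code_inj A B : form_code A = form_code B -> A = B.
Proof.
  revert B; induction A; intros [] H; cbn in H; apply pair_inj in H as [H0 H];
    try discriminate; try apply pair_inj in H as [H H']; f_equal;
    auto using term_code_inj.
Qed.

(** * Extending a bounded valuation *)

(** Pigeonhole: an increasing chain of subsets of {0, ..., M - 1} cannot grow strictly [M + 1]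
    times. *)
Lemma chain_stabilizes (P : nat -> nat -> Prop) M :
  (forall k i, P k i -> P (S k) i) ->
  exists k, k <= M /\ forall i, i < M -> P (S k) i -> P k i.
Proof.
  intros Hmono.
  set (p k i := if excluded_middle_informative (P k i) then true else false).
  assert (Hp : forall k i, p k i = true <-> P k i).
  { intros k i; unfold p; destruct excluded_middle_informative; split; easy. }
  set (card k l := length (filter (p k) l)).
  assert (Hle : forall k l, card k l <= card (S k) l).
  { intros k l; unfold card; induction l as [|i l IH]; trivial; cbn [filter].
    pose proof (Hp k i) as H; pose proof (Hp (S k) i) as H'; pose proof (Hmono k i).
    destruct (p k i), (p (S k) i); cbn [length]; try lia.
    now assert (false = true) by intuition. }
  assert (Hlt : forall k l i, In i l -> P (S k) i -> ~ P k i -> card k l < card (S k) l).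
  { intros k l i Hi Hi1 Hi0. rewrite <- Hp in Hi0, Hi1.
    apply in_split in Hi as (l1 & l2 & ->).
    pose proof (Hle k l1) as H1; pose proof (Hle k l2) as H2; unfold card in *.
    rewrite !filter_app, !length_app; cbn [filter].
    rewrite Hi1; destruct (p k i); [easy|]. cbn [length]; lia. }
  apply NNPP; intros Hn.
  (* Without a stable stage each step adds an element, so stage [S M] would hold more than [M]
     elements. *)
  assert (Hgrow : forall k, k <= S M -> k <= card k (seq 0 M)).
  { induction k as [|k IH]; [lia|]; intros Hk.
    enough (card k (seq 0 M) < card (S k) (seq 0 M)) by (specialize (IH ltac:(lia)); lia).
    apply NNPP; intros Hc. apply Hn; exists k; split; [lia|]; intros i Hi Hi1.
    apply NNPP; intros Hi0. apply Hc, Hlt with i; trivial. apply in_seq; lia. }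
  specialize (Hgrow (S M) (le_n _)).
  pose proof (filter_length_le (p (S M)) (seq 0 M)) as H; rewrite length_seq in H.
  unfold card in Hgrow; lia.
Qed.

(** Bounds for the codes of the terms that can witness the derivation of [Bot]
    from the evidence: one application of [.] leads from one level to the next. *)
Definition level (M k : nat) : nat :=
  nat_rect (fun _ => nat) (pair M M) (fun _ r => pair (pair r r) (pair r r)) k.

Lemma le_pair_l a b : a <= pair a b.
Proof. pose proof (Cantor.to_nat_non_decreasing a b); lia. Qed.

Lemma le_pair_r a b : b <= pair a b.
Proof. pose proof (Cantor.to_nat_non_decreasing a b); lia. Qed.

Lemma level_S M k : level M k <= level M (S k).
Proof. cbn; etransitivity; [apply (le_pair_l _ (level M k))|apply le_pair_l]. Qed.

Lemma level_mono M k k' : k <= k' -> level M k <= level M k'.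
Proof. induction 1; trivial. etransitivity; [eassumption|apply level_S]. Qed.

Lemma le_level M k : M <= level M k.
Proof. transitivity (level M 0); [apply le_pair_l|apply level_mono; lia]. Qed.

Definition small_term (L : logic) (K : nat) (t : term) : Prop :=
  JLterm L t /\ term_code t <= K.

Definition small_form (L : logic) (M : nat) (A : form) : Prop :=
  JLform L A /\ form_code A <= M.

(** The conditions on a valuation [w] imposed by those instances of the axioms
    whose terms and formulas are small. *)
Record local_model (L : logic) (N : nat) (w : form -> Prop) : Prop := {
  lm_bot : ~ w Bot;
  lm_neg A : small_form L N A -> w (Neg A) <-> ~ w A;
  lm_imp A B : small_form L N A -> small_form L N B -> w (Imp A B) <-> (w A -> w B);
  lm_suml s t A : small_term L N s -> small_term L N t -> small_form L N A ->
    w (Just s A) -> w (Just (tsum s t) A);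
  lm_sumr s t A : small_term L N s -> small_term L N t -> small_form L N A ->
    w (Just s A) -> w (Just (tsum t s) A);
  lm_jK s t A B : small_term L N s -> small_term L N t ->
    small_form L N A -> small_form L N B ->
    w (Just s (Imp A B)) -> w (Just t A) -> w (Just (tapp s t) B);
  lm_jT t A : jT L = true -> small_term L N t -> small_form L N A ->
    w (Just t A) -> w A;
  lm_jD t : jD L = true -> small_term L N t -> ~ w (Just t Bot);
  lm_j4 t A : j4 L = true -> small_term L N t -> small_form L N A ->
    w (Just t A) -> w (Just (tbang t) (Just t A));
  lm_jB t A : jB L = true -> small_term L N t -> small_form L N A ->
    ~ w A -> w (Just (twquest t) (Neg (Just t A)));
  lm_j5 t A : j5 L = true -> small_term L N t -> small_form L N A ->
    ~ w (Just t A) -> w (Just (tquest t) (Neg (Just t A)))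
}.

Section Extension.
Variables (L : logic) (M : nat) (w : form -> Prop).
Hypothesis M_ge : 6 <= M.
Hypothesis w_local : local_model L (level M (S M)) w.

Let X := small_form L M.
(** The bound [pair M M] leaves room for one unary operation on a term with code at most [M], as j4,
    jB and j5 require. *)
Let T0 := small_term L (level M 0).

Lemma X_big A : X A -> small_form L (level M (S M)) A.
Proof. intros [HJ Hc]; split; trivial. etransitivity; [exact Hc|apply le_level]. Qed.

Lemma T0_big t : T0 t -> small_term L (level M (S M)) t.
Proof. intros [HJ Hc]; split; trivial. etransitivity; [exact Hc|apply level_mono; lia]. Qed.

Lemma X_Neg A : X (Neg A) -> X A.
Proof.
  intros [HJ Hc]; split; trivial. etransitivity; [|exact Hc]. apply le_pair_r.
Qed.

Lemma X_Imp A B : X (Imp A B) -> X A /\ X B.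
Proof.
  intros [[] Hc]; cbn in Hc.
  pose proof (le_pair_r 3 (pair (form_code A) (form_code B))).
  pose proof (le_pair_l (form_code A) (form_code B)).
  pose proof (le_pair_r (form_code A) (form_code B)).
  split; split; trivial; lia.
Qed.

Lemma X_Just t A : X (Just t A) -> small_term L M t /\ X A.
Proof.
  intros [[] Hc]; cbn in Hc.
  pose proof (le_pair_r 4 (pair (term_code t) (form_code A))).
  pose proof (le_pair_l (term_code t) (form_code A)).
  pose proof (le_pair_r (term_code t) (form_code A)).
  split; split; trivial; lia.
Qed.

Lemma X_Bot : X Bot.
Proof.
  split; [exact I|]. cbn. pose proof (Cantor.to_nat_spec 1 0); lia.
Qed.

Lemma T0_small t : small_term L M t -> T0 t.
Proof. intros []; split; trivial. etransitivity; [eassumption|apply (le_level M 0)]. Qed.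

Lemma T0_bang t : j4 L = true -> small_term L M t -> T0 (tbang t).
Proof. intros ? []; split; [now split|]; apply pair_le; [lia|trivial]. Qed.

Lemma T0_wquest t : jB L = true -> small_term L M t -> T0 (twquest t).
Proof. intros ? []; split; [now split|]; apply pair_le; [lia|trivial]. Qed.

Lemma T0_quest t : j5 L = true -> small_term L M t -> T0 (tquest t).
Proof. intros ? []; split; [now split|]; apply pair_le; [lia|trivial]. Qed.

Lemma T0_binary s t k : JLterm L s /\ JLterm L t ->
  pair k (pair (term_code s) (term_code t)) <= level M 0 -> T0 s /\ T0 t.
Proof.
  intros [] Hc.
  pose proof (le_pair_r k (pair (term_code s) (term_code t))).
  pose proof (le_pair_l (term_code s) (term_code t)).
  pose proof (le_pair_r (term_code s) (term_code t)).
  split; split; trivial; lia.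
Qed.

(** Evidence for formulas of [X]: as prescribed by [w] for the terms of [T0],
    and otherwise the least one closed under [.] and [+]. *)
Fixpoint near (t : term) (A : form) {struct t} : Prop :=
  X A /\ (T0 t /\ w (Just t A) \/
    ~ T0 t /\ match t with
              | tapp r s => exists B, near r (Imp B A) /\ near s B
              | tsum r s => near r A \/ near s A
              | _ => False
              end).

(** Evidence for a formula [A] outside [X], given the truth value [VA] of [A]
    and, for [A = Neg (Just t B)], that of [B]. No implication outside [X] has
    evidence, so that [.] contributes nothing here. *)
Fixpoint far (t : term) (A : form) (VA VB : Prop) {struct t} : Prop :=
  match t with
  | tsum r s => far r A VA VB \/ far s A VA VB
  | tbang r => (exists B, A = Just r B) /\ VA
  | twquest r => (exists B, A = Neg (Just r B)) /\ ~ VB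
  | tquest r => (exists B, A = Neg (Just r B)) /\ VA
  | _ => False
  end.

(** [far] recurses on the term, so the truth values of subformulas are handed to it as propositions
    and [ext] stays structural in the formula. *)
Fixpoint ext (A : form) : Prop :=
  match A with
  | Var _ => w A
  | Bot => False
  | Neg B => ~ ext B
  | Imp B C => ext B -> ext C
  | Just t B => near t B \/
      ~ X B /\ far t B (ext B) (match B with Neg (Just _ C) => ext C | _ => False end)
  end.

(** * The extended valuation satisfies the axioms *)

Lemma near_X t A : near t A -> X A.
Proof. destruct t; now intros []. Qed.

Lemma near_T0 t A : T0 t -> near t A <-> X A /\ w (Just t A).
Proof. destruct t; cbn; tauto. Qed.

Lemma ext_Just_X t A : X A -> ext (Just t A) <-> near t A.
Proof. cbn; tauto. Qed.

(** Terms [t] of formulas [t:A] in [X] lie in [T0], where [near] copies [w]; the connectives are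
    handled by the local model. *)
Lemma ext_X A : X A -> ext A <-> w A.
Proof.
  induction A as [n| |A IH|A IHA B IHB|t A IH]; intros HX.
  - reflexivity.
  - pose proof (lm_bot _ _ _ w_local); cbn; tauto.
  - apply X_Neg in HX. rewrite (lm_neg _ _ _ w_local) by now apply X_big.
    cbn; now rewrite IH.
  - apply X_Imp in HX as []. rewrite (lm_imp _ _ _ w_local) by now apply X_big.
    cbn; now rewrite IHA, IHB.
  - apply X_Just in HX as []. rewrite ext_Just_X by trivial.
    rewrite near_T0 by now apply T0_small. tauto.
Qed.

Lemma ext_sum s t A : JLterm L s -> JLterm L t ->
  ext (Just s A) \/ ext (Just t A) -> ext (Just (tsum s t) A).
Proof.
  intros Hs Ht H. destruct (classic (X A)) as [HX|HX]; 
    [|pose proof (near_X s A); pose proof (near_X t A); cbn in *; tauto].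
  rewrite !ext_Just_X in * by trivial.
  destruct (classic (T0 (tsum s t))) as [HT|HT]; [|cbn; tauto].
  rewrite near_T0 by trivial; split; trivial.
  destruct HT as [HJ Hc]; cbn in Hc; apply T0_binary in Hc as []; trivial.
  destruct H as [H|H]; apply near_T0 in H as []; trivial;
    [apply (lm_suml _ _ _ w_local)|apply (lm_sumr _ _ _ w_local)];
    auto using X_big, T0_big.
Qed.

(** [far] accepts only formulas [r:B] and their negations, never implications; this confines jK to
    [X]. *)
Lemma ext_Just_Imp t A B : ext (Just t (Imp A B)) -> near t (Imp A B).
Proof.
  intros [H|[_ H]]; trivial; exfalso; revert H.
  generalize (ext (Imp A B)); intros V.
  induction t; cbn; try tauto; now intros [[? [=]] _].
Qed.

Lemma ext_app s t A B : JLterm L s -> JLterm L t ->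
  ext (Just s (Imp A B)) -> ext (Just t A) -> ext (Just (tapp s t) B).
Proof.
  intros Hs Ht H1 H2. apply ext_Just_Imp in H1.
  destruct (X_Imp _ _ (near_X _ _ H1)) as [HA HB].
  rewrite ext_Just_X in * by trivial.
  destruct (classic (T0 (tapp s t))) as [HT|HT].
  - rewrite near_T0 by trivial; split; trivial.
    destruct HT as [HJ Hc]; cbn in Hc; apply T0_binary in Hc as []; trivial.
    apply near_T0 in H1 as [], H2 as []; trivial.
    apply (lm_jK _ _ _ w_local) with A; auto using X_big, T0_big.
  - split; trivial; right; split; eauto.
Qed.

(** Evidence copied from [w] is sound by jT there; an application adds a modus ponens inside [w]. *)
Lemma near_sound t A : jT L = true -> near t A -> w A.
Proof.
  intros HL; revert A.
  induction t as [n|n|s IHs t IHt|s IHs t IHt|t IH|t IH|t IH];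
    intros A (HX & [[HT Hw]|[_ H]]);
    try (apply (lm_jT _ _ _ w_local) in Hw; auto using X_big, T0_big);
    try contradiction.
  - destruct H as (B & H1 & H2).
    destruct (X_Imp _ _ (near_X _ _ H1)).
    apply IHs in H1; apply IHt in H2.
    apply (lm_imp _ _ _ w_local B A); auto using X_big.
  - destruct H; auto.
Qed.

Lemma ext_jT t A : jT L = true -> ext (Just t A) -> ext A.
Proof.
  intros HL; revert A.
  assert (Hnear : forall t A, near t A -> ext A).
  { intros s A H; apply ext_X; [now apply near_X with s|now apply near_sound with s]. }
  induction t as [n|n|s IHs t IHt|s IHs t IHt|t IH|t IH|t IH];
    intros A [H|[HX H]]; eauto; cbn [far] in H; try tauto.
  - destruct H; [apply IHs|apply IHt]; cbn; tauto.
  (* The jB case: evidence for [B] would make [B] true by induction, but [far] demanded that [B] be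
     false. *)
  - destruct H as [(B & ->) HB]. intros HJ. now apply HB, IH.
Qed.

(** Any evidence from [near] can be traded for a term of a stable level [k] with evidence in [w],
    and there jD excludes [Bot]. *)
Lemma ext_jD t : jD L = true -> ~ ext (Just t Bot).
Proof.
  intros HL. rewrite ext_Just_X by apply X_Bot.
  (* Formulas of [X] have codes in {0, ..., M}, hence [S M] possible codes and a stable [k <= S M];
     this explains the level [S M] in [w_local]. *)
  destruct (chain_stabilizes (fun k i => exists A t, form_code A = i /\ X A /\
    small_term L (level M k) t /\ w (Just t A)) (S M)) as (k & Hk & Hst).
  { intros k i (A & s & Hi & HA & [HJ Hc] & Hw); exists A, s; repeat split; trivial;
      try apply HA. etransitivity; [exact Hc|apply level_S]. }
  assert (Hbig : forall s, small_term L (level M k) s -> small_term L (level M (S M)) s).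
  { intros s [HJ Hc]; split; trivial. etransitivity; [exact Hc|now apply level_mono]. }
  assert (HD : forall s A, near s A ->
    exists r, small_term L (level M k) r /\ w (Just r A)).
  { induction s as [n|n|s IHs r IHr|s IHs r IHr|s IH|s IH|s IH];
      intros A (HX & [[[HJ Hc] Hw]|[_ H]]);
      try (eexists; split; [split; [exact HJ|]|exact Hw];
           etransitivity; [exact Hc|apply (level_mono M 0), Nat.le_0_l]);
      try contradiction.
    - destruct H as (B & H1 & H2).
      destruct (X_Imp _ _ (near_X _ _ H1)) as [HB HA].
      apply IHs in H1 as (s' & Hs' & Hw1); apply IHr in H2 as (r' & Hr' & Hw2).
      destruct (Hst (form_code A)) as (A' & q & HA' & _ & Hq & Hw).
      + apply Nat.lt_succ_r, HX.
      + exists A, (tapp s' r'); repeat split; trivial; try apply HX.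
        * apply Hs'.
        * apply Hr'.
        (* The application of two terms of level [k] has level [S k]; its tag 2 fits since [6 <= M].
           Stability then returns to level [k]. *)
        * destruct Hs', Hr'. pose proof (le_level M k).
          apply pair_le; [|now apply pair_le].
          transitivity (level M k); [lia|apply le_pair_l].
        * apply (lm_jK _ _ _ w_local) with B; auto using X_big.
      + apply form_code_inj in HA' as ->. now exists q.
    - destruct H; auto. }
  intros H. apply HD in H as (r & Hr & Hw).
  exact (lm_jD _ _ _ w_local r HL (Hbig r Hr) Hw).
Qed.

Lemma ext_j4 t A : j4 L = true -> ext (Just t A) -> ext (Just (tbang t) (Just t A)).
Proof.
  intros HL H. destruct (classic (X (Just t A))) as [HX|HX].
  - rewrite ext_Just_X by trivial. pose proof (X_Just _ _ HX) as [Ht HA].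
    rewrite near_T0 by now apply T0_bang. split; trivial.
    apply ext_X in H; trivial.
    apply (lm_j4 _ _ _ w_local); auto using X_big, T0_small, T0_big.
  - right; cbn [far]; eauto.
Qed.

Lemma ext_j5 t A : j5 L = true ->
  ~ ext (Just t A) -> ext (Just (tquest t) (Neg (Just t A))).
Proof.
  intros HL H. destruct (classic (X (Neg (Just t A)))) as [HX|HX].
  - rewrite ext_Just_X by trivial. pose proof (X_Just _ _ (X_Neg _ HX)) as [Ht HA].
    rewrite near_T0 by now apply T0_quest. split; trivial.
    rewrite ext_X in H by now apply X_Neg.
    apply (lm_j5 _ _ _ w_local); auto using X_big, T0_small, T0_big.
  - right; cbn [far]; eauto.
Qed.

Lemma ext_jB t A : jB L = true ->
  ~ ext A -> ext (Just (twquest t) (Neg (Just t A))).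
Proof.
  intros HL H. destruct (classic (X (Neg (Just t A)))) as [HX|HX].
  - rewrite ext_Just_X by trivial. pose proof (X_Just _ _ (X_Neg _ HX)) as [Ht HA].
    rewrite near_T0 by now apply T0_wquest. split; trivial.
    rewrite ext_X in H by trivial.
    apply (lm_jB _ _ _ w_local); auto using X_big, T0_small, T0_big.
  - right; cbn [far]; eauto.
Qed.

Definition ext_val (A : form) : bool :=
  if excluded_middle_informative (ext A) then true else false.

(** [ext] commutes with the connectives, so it is a propositional valuation and satisfies every
    tautology. *)
Lemma truth_ext_val A : truth ext_val A = true <-> ext A.
Proof.
  induction A as [n| |A IH|A IHA B IHB|t A IH]; cbn [truth].
  1,5: unfold ext_val; destruct excluded_middle_informative; split; easy.
  - easy.
  - cbn [ext]; rewrite <- IH; destruct (truth ext_val A); cbn; split; congruence.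
  - cbn [ext]; rewrite <- IHA, <- IHB.
    destruct (truth ext_val A), (truth ext_val B); cbn; intuition congruence.
Qed.

Lemma ext_axiom A : axiom L A -> ext A.
Proof.
  intros [HJ HA]; destruct HA; cbn [JLform JLterm] in HJ.
  - apply truth_ext_val; auto.
  - intros HE; apply ext_sum; tauto.
  - intros HE; apply ext_sum; tauto.
  - intros H1 H2; apply ext_app with A; tauto.
  - intros HE; now apply ext_jT with t.
  - intros HE; now apply ext_jD with t.
  - intros HE; now apply ext_j4.
  - intros HE; now apply ext_jB.
  - intros HE; now apply ext_j5.
Qed.

Lemma provable_local_model CS F : (forall A, CS A -> X A /\ w A) ->
  X F -> provable L CS F -> w F.
Proof.
  intros HCS HF HP. apply ext_X; trivial; clear HF.
  induction HP as [A HA|A B _ IH1 _ IH2|A HA].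
  - now apply ext_axiom.
  - now apply IH1.
  - destruct (HCS A HA); now apply ext_X.
Qed.

End Extension.

(** * The decision procedure *)

(** Moving the members of [l] in front of [F] as nested implications gives a tautology; modus ponens
    then discharges them. *)
Lemma provable_of_tautology L CS (l : list form) F :
  (forall A, In A l -> JLform L A /\ provable L CS A) -> JLform L F ->
  (forall v, (forall A, In A l -> truth v A = true) -> truth v F = true) ->
  provable L CS F.
Proof.
  revert F; induction l as [|A l IH]; intros F Hl HF Hv.
  - apply pr_axiom; split; trivial. apply sc_taut; intros v; now apply Hv.
  - apply pr_mp with A; [|apply Hl; now left].
    apply IH.
    + intros B HB; apply Hl; now right.
    + split; trivial. apply Hl; now left.
    + intros v Hl'; cbn. destruct (truth v A) eqn:HA; trivial.
      apply Hv. intros B [<-|HB]; auto.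
Qed.

(** Injectivity of the coding gives at most one formula per code. *)
Lemma bounded_forms_listable (P : form -> Prop) R :
  exists l, forall A, In A l <-> form_code A < R /\ P A.
Proof.
  induction R as [|R (l & Hl)].
  - exists []; intros A; cbn; lia.
  - destruct (classic (exists A, form_code A = R /\ P A)) as [(A & HA & HP)|Hn].
    + exists (A :: l); intros B; cbn; rewrite Hl; split.
      * intros [<-|[]]; split; trivial; lia.
      * intros [HB HPB]. rewrite Nat.lt_succ_r, Nat.lt_eq_cases in HB; destruct HB as [HB|HB].
        -- right; now split.
        -- left; apply form_code_inj; congruence.
    + exists l; intros B; rewrite Hl; split; intros [HB HPB]; split; trivial; [lia|].
      rewrite Nat.lt_succ_r, Nat.lt_eq_cases in HB; destruct HB as [HB|HB]; trivial.
      now destruct Hn; exists B.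
Qed.

(** * Certificates as arithmetical local models *)

Local Notation c_neg a := (pair 2 a) (only parsing).
Local Notation c_imp a b := (pair 3 (pair a b)) (only parsing).
Local Notation c_just s a := (pair 4 (pair s a)) (only parsing).

(** A certificate [Z] codes three sets of Goedel numbers, tagged by 0, 1 and 2: the
    terms and the formulas of the language, and the formulas taken to be true. *)
Definition locally_closed (L : logic) (Z : nat -> Prop) (s t a b : nat) : Prop :=
  let Tm x := Z (pair 0 x) in
  let Fm x := Z (pair 1 x) in
  let Tr x := Z (pair 2 x) in
  ((Tm (pair 0 s) /\ Tm (pair 1 s)) /\
   (Tm s -> Tm t -> Tm (pair 2 (pair s t)) /\ Tm (pair 3 (pair s t))) /\
   (j4 L = true -> Tm s -> Tm (pair 4 s)) /\
   (jB L = true -> Tm s -> Tm (pair 5 s)) /\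
   (j5 L = true -> Tm s -> Tm (pair 6 s))) /\
  (Fm (pair 0 s) /\ Fm (pair 1 0) /\
   (Fm a -> Fm (c_neg a)) /\
   (Fm a -> Fm b -> Fm (c_imp a b)) /\
   (Tm s -> Fm a -> Fm (c_just s a))) /\
  (~ Tr (pair 1 0) /\
   (Fm a -> (Tr (c_neg a) <-> ~ Tr a)) /\
   (Fm a -> Fm b -> (Tr (c_imp a b) <-> (Tr a -> Tr b)))) /\
  ((Tm s -> Tm t -> Fm a -> Tr (c_just s a) -> Tr (c_just (pair 3 (pair s t)) a)) /\
   (Tm s -> Tm t -> Fm a -> Tr (c_just s a) -> Tr (c_just (pair 3 (pair t s)) a)) /\
   (Tm s -> Tm t -> Fm a -> Fm b -> Tr (c_just s (c_imp a b)) -> Tr (c_just t a) ->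
    Tr (c_just (pair 2 (pair s t)) b)) /\
   (jT L = true -> Tm s -> Fm a -> Tr (c_just s a) -> Tr a) /\
   (jD L = true -> Tm s -> ~ Tr (c_just s (pair 1 0))) /\
   (j4 L = true -> Tm s -> Fm a -> Tr (c_just s a) ->
    Tr (c_just (pair 4 s) (c_just s a))) /\
   (jB L = true -> Tm s -> Fm a -> ~ Tr a ->
    Tr (c_just (pair 5 s) (c_neg (c_just s a)))) /\
   (j5 L = true -> Tm s -> Fm a -> ~ Tr (c_just s a) ->
    Tr (c_just (pair 6 s) (c_neg (c_just s a))))).

(** Bounds whatever arises from numbers up to [x] by at most [k] nested pairings. The value 12 used
    below exceeds the nesting depth of all axiom codes and certificate queries. *)
Definition tower (k x : nat) : nat := nat_rect (fun _ => nat) x (fun _ r => pair r r) k.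

Lemma le_tower k a x : a <= x -> a <= tower k x.
Proof.
  intros Ha; induction k as [|k IH]; [exact Ha|].
  etransitivity; [exact IH|apply le_pair_l].
Qed.

Lemma pair_le_tower k a b x :
  a <= tower k x -> b <= tower k x -> pair a b <= tower (S k) x.
Proof. apply pair_le. Qed.

Ltac bound :=
  match goal with
  | |- _ < S _ => apply Nat.lt_succ_r; bound
  | |- pair _ _ <= tower _ _ => apply pair_le_tower; bound
  | |- _ => apply le_tower; lia
  end.

(** The condition consults the set only at indices up to [tower 12 x], so a finite initial segment
    of it decides. *)
Lemma locally_closed_ext L Z Z' x s t a b : 6 <= x ->
  s <= x -> t <= x -> a <= x -> b <= x ->
  (forall i, i < S (tower 12 x) -> Z i <-> Z' i) ->
  locally_closed L Z' s t a b -> locally_closed L Z s t a b.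
Proof.
  intros Hx Hs Ht Ha Hb H. unfold locally_closed; cbv zeta.
  rewrite !H by bound. trivial.
Qed.

(** The intended certificate of a valuation; being infinite, it is later coded only up to a
    bound. *)
Definition real_certificate (L : logic) (v : form -> bool) (i : nat) : Prop :=
  match lft i with
  | 0 => exists t, JLterm L t /\ term_code t = rgt i
  | 1 => exists A, JLform L A /\ form_code A = rgt i
  | _ => exists A, truth v A = true /\ form_code A = rgt i
  end.

Section RealCertificate.
Variables (L : logic) (v : form -> bool) (x : nat).
Hypothesis x_ge : 6 <= x.
Hypothesis v_axioms :
  forall A, form_code A < S (tower 12 x) -> axiom L A -> truth v A = true.

Lemma real_term n :
  real_certificate L v (pair 0 n) <-> exists t, JLterm L t /\ term_code t = n.
Proof. unfold real_certificate; now rewrite lft_pair, rgt_pair. Qed.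

Lemma real_form n :
  real_certificate L v (pair 1 n) <-> exists A, JLform L A /\ form_code A = n.
Proof. unfold real_certificate; now rewrite lft_pair, rgt_pair. Qed.

Lemma real_truth A : real_certificate L v (pair 2 (form_code A)) <-> truth v A = true.
Proof.
  unfold real_certificate; rewrite lft_pair, rgt_pair; split.
  - now intros (B & HB & ->%form_code_inj).
  - now exists A.
Qed.

(** Each justification clause is an axiom instance with code in the range where [v] is assumed to
    satisfy the axioms. *)
Lemma real_closed s t a b : s <= x -> t <= x -> a <= x -> b <= x ->
  locally_closed L (real_certificate L v) s t a b.
Proof.
  intros Hs Ht Ha Hb; unfold locally_closed; cbv zeta.
  assert (Hax : forall A B, form_code (Imp A B) <= tower 12 x -> axiom L (Imp A B) ->
    truth v A = true -> real_certificate L v (pair 2 (form_code B))).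
  { intros A B Hc HA HvA. specialize (v_axioms (Imp A B)); cbn [truth] in v_axioms.
    rewrite HvA in v_axioms. apply real_truth, v_axioms; trivial. now apply Nat.lt_succ_r. }
  rewrite !real_term, !real_form.
  repeat apply conj.
  - now exists (tvar s).
  - now exists (tconst s).
  - intros (s' & Hs' & <-) (t' & Ht' & <-); split;
      [now exists (tapp s' t')|now exists (tsum s' t')].
  - intros HL (s' & Hs' & <-); now exists (tbang s').
  - intros HL (s' & Hs' & <-); now exists (twquest s').
  - intros HL (s' & Hs' & <-); now exists (tquest s').
  - now exists (Var s).
  - now exists Bot.
  - intros (A & HA & <-); now exists (Neg A).
  - intros (A & HA & <-) (B & HB & <-); now exists (Imp A B).
  - intros (s' & Hs' & <-) (A & HA & <-); now exists (Just s' A).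
  - intros H; apply (real_truth Bot) in H; discriminate.
  - intros (A & HA & <-); rewrite (real_truth A).
    transitivity (truth v (Neg A) = true); [apply (real_truth (Neg A))|].
    cbn; destruct (truth v A); cbn; intuition congruence.
  - intros (A & HA & <-) (B & HB & <-); rewrite (real_truth A), (real_truth B).
    transitivity (truth v (Imp A B) = true); [apply (real_truth (Imp A B))|].
    cbn; destruct (truth v A), (truth v B); cbn; intuition congruence.
  - intros (s' & Hs' & <-) (t' & Ht' & <-) (A & HA & <-) H.
    apply (Hax (Just s' A) (Just (tsum s' t') A)), (real_truth (Just s' A)), H.
    + cbn [form_code term_code]; bound.
    + repeat split; trivial; now apply sc_suml.
  - intros (s' & Hs' & <-) (t' & Ht' & <-) (A & HA & <-) H.
    apply (Hax (Just s' A) (Just (tsum t' s') A)), (real_truth (Just s' A)), H.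
    + cbn [form_code term_code]; bound.
    + repeat split; trivial; now apply sc_sumr.
  - intros (s' & Hs' & <-) (t' & Ht' & <-) (A & HA & <-) (B & HB & <-) H1 H2.
    apply (real_truth (Just s' (Imp A B))) in H1.
    apply (real_truth (Just t' A)) in H2.
    apply (real_truth (Just (tapp s' t') B)).
    assert (H : axiom L (Imp (Just s' (Imp A B)) (Imp (Just t' A) (Just (tapp s' t') B))))
      by (repeat split; trivial; apply sc_jK).
    apply v_axioms in H; [|cbn [form_code term_code]; bound].
    cbn [truth] in *. now rewrite H1, H2 in H.
  - intros HL (s' & Hs' & <-) (A & HA & <-) H.
    apply (Hax (Just s' A) A), (real_truth (Just s' A)), H.
    + cbn [form_code term_code]; bound.
    + repeat split; trivial; now apply sc_jT.
  - intros HL (s' & Hs' & <-) H.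
    apply (real_truth (Just s' Bot)), (Hax (Just s' Bot) Bot), real_truth in H;
      [discriminate| |].
    + cbn [form_code term_code]; bound.
    + repeat split; trivial; now apply sc_jD.
  - intros HL (s' & Hs' & <-) (A & HA & <-) H.
    apply (Hax (Just s' A) (Just (tbang s') (Just s' A))), (real_truth (Just s' A)), H.
    + cbn [form_code term_code]; bound.
    + repeat split; trivial; now apply sc_j4.
  - intros HL (s' & Hs' & <-) (A & HA & <-) H.
    apply (Hax (Neg A) (Just (twquest s') (Neg (Just s' A)))).
    + cbn [form_code term_code]; bound.
    + repeat split; trivial; now apply sc_jB.
    + rewrite real_truth in H; cbn; now destruct (truth v A).
  - intros HL (s' & Hs' & <-) (A & HA & <-) H.
    apply (Hax (Neg (Just s' A)) (Just (tquest s') (Neg (Just s' A)))).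
    + cbn [form_code term_code]; bound.
    + repeat split; trivial; now apply sc_j5.
    + assert (H' : truth v (Just s' A) <> true)
        by (intros H'; apply H, (real_truth (Just s' A)), H').
      cbn in *; now destruct (v (Just s' A)).
Qed.
End RealCertificate.

(** * The bounded search and its correctness *)

Section Procedure.
Variables (L : logic) (CS : form -> Prop) (lCS : list form).
Hypothesis CS_spec : forall A, CS A <-> In A lCS.
Hypothesis CS_form : forall A, CS A -> JLform L A.

(** The 6 leaves room for all constructor tags; the sum dominates the code of each member of CS. *)
Definition offset : nat := 6 + list_sum (map form_code lCS).
Definition term_bound (n : nat) : nat := level (n + offset) (S (n + offset)).
(** Bounds coded quadruples, so that one bounded quantifier replaces four. *)
Definition box (n : nat) : nat :=
  let N := term_bound n in S (pair N (pair N (pair N N))).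
Definition certificates (n : nat) : nat := certificate_bound (S (tower 12 (box n))).

Definition accepted (n c : nat) : Prop :=
  (forall m, m < box n ->
    locally_closed L (entry c) (lft m) (lft (rgt m)) (lft (rgt (rgt m)))
      (rgt (rgt (rgt m)))) /\
  Forall (fun A => entry c (pair 2 (form_code A))) lCS.

Definition decision (n : nat) : Prop :=
  forall c, c < certificates n -> accepted n c -> entry c (pair 2 n).

Lemma computable_nat_iter g f h : computable f -> computable h ->
  computable g ->
  computable (fun n => nat_rect (fun _ => nat) (f n) (fun _ r => g r) (h n)).
Proof.
  intros Hf Hh Hg. apply (computable_rec f (fun _ _ r => g r)); trivial.
  apply (computable_comp g); trivial. apply computable_rgt, computable_rgt, computable_id.
Qed.

Lemma computable_term_bound : computable term_bound.
Proof.
  assert (Hm : computable (fun n => n + offset)) by apply computable_add_const, computable_id.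
  unfold term_bound, level.
  apply (computable_nat_iter (fun r => pair (pair r r) (pair r r)));
    auto using computable_pair, computable_succ, computable_id.
Qed.

Lemma computable_box : computable box.
Proof.
  unfold box; cbv zeta. pose proof computable_term_bound.
  auto using computable_pair, computable_succ.
Qed.

Lemma computable_certificates : computable certificates.
Proof.
  apply (computable_nat_iter (fun r => S (pair 1 r)));
    auto using computable_pair, computable_succ, computable_id, computable_const.
  apply computable_succ, (computable_nat_iter (fun r => pair r r));
    auto using computable_pair, computable_id, computable_const, computable_box.
Qed.

Lemma recursive_locally_closed z s t a b :
  computable z -> computable s -> computable t -> computable a -> computable b ->
  recursive (fun n => locally_closed L (entry (z n)) (s n) (t n) (a n) (b n)).
Proof.
  intros; unfold locally_closed; cbv zeta.
  repeat first
    [ apply recursive_entry | apply recursive_and | apply recursive_not | apply recursive_iff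
    | apply recursive_const | apply recursive_impl
    | apply computable_pair | apply computable_const | assumption ].
Qed.

Lemma recursive_decision : recursive decision.
Proof.
  assert (Hz : computable (fun x => rgt x)) by apply computable_rgt, computable_id.
  assert (Hn : computable (fun x => lft x)) by apply computable_lft, computable_id.
  apply recursive_forall_lt; [apply computable_certificates|].
  apply recursive_impl; [apply recursive_and|].
  - apply (recursive_forall_lt (fun x m => locally_closed L (entry (rgt x)) (lft m)
      (lft (rgt m)) (lft (rgt (rgt m))) (rgt (rgt (rgt m))))).
    + apply (computable_comp box); [apply computable_box|trivial].
    + apply recursive_locally_closed;
        auto 10 using computable_lft, computable_rgt, computable_id.
  - clear CS_spec; induction lCS as [|A l IH].
    + apply recursive_ext with (fun _ => True); [|apply recursive_const].
      now intros n; split.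
    + apply recursive_ext with (fun x => entry (rgt x) (pair 2 (form_code A)) /\
        Forall (fun A => entry (rgt x) (pair 2 (form_code A))) l).
      { intros n; now rewrite Forall_cons_iff. }
      apply recursive_and; trivial.
      apply recursive_entry; auto using computable_const.
  - apply recursive_entry; auto using computable_pair, computable_const.
Qed.

Lemma pair_le_inv a b N : pair a b <= N -> a <= N /\ b <= N.
Proof. pose proof (le_pair_l a b); pose proof (le_pair_r a b); lia. Qed.

Lemma accepted_local_model n c : accepted n c ->
  local_model L (term_bound n) (fun A => entry c (pair 2 (form_code A))).
Proof.
  intros [Hc _].
  set (N := term_bound n) in *.
  assert (Hcl : forall s t a b, s <= N -> t <= N -> a <= N -> b <= N ->
    locally_closed L (entry c) s t a b).
  { intros s t a b Hs Ht Ha Hb.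
    specialize (Hc (pair s (pair t (pair a b)))).
    rewrite !rgt_pair, !lft_pair in Hc. apply Hc, Nat.lt_succ_r.
    now repeat apply pair_le. }
  clear Hc. pose proof (Nat.le_0_l N) as H0.
  (* Closure forces the certificate to recognise all small terms and formulas; anything else it
     recognises only adds constraints. Zeros fill the other slots of [Hcl]. *)
  assert (Hterm : forall t, small_term L N t -> entry c (pair 0 (term_code t))).
  { induction t as [i|i|s IHs t IHt|s IHs t IHt|t IH|t IH|t IH]; intros [HJ Hle];
      apply pair_le_inv in Hle as [_ Hle].
    - destruct (Hcl i 0 0 0) as (((H & _) & _) & _); trivial.
    - destruct (Hcl i 0 0 0) as (((_ & H) & _) & _); trivial.
    - apply pair_le_inv in Hle as [Hs Ht]; destruct HJ as [HJ1 HJ2].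
      destruct (Hcl (term_code s) (term_code t) 0 0) as ((_ & H & _) & _); trivial.
      apply H; [apply IHs|apply IHt]; now split.
    - apply pair_le_inv in Hle as [Hs Ht]; destruct HJ as [HJ1 HJ2].
      destruct (Hcl (term_code s) (term_code t) 0 0) as ((_ & H & _) & _); trivial.
      apply H; [apply IHs|apply IHt]; now split.
    - destruct HJ as [HL HJ].
      destruct (Hcl (term_code t) 0 0 0) as ((_ & _ & H & _) & _); trivial.
      apply H; trivial; apply IH; now split.
    - destruct HJ as [HL HJ].
      destruct (Hcl (term_code t) 0 0 0) as ((_ & _ & _ & H & _) & _); trivial.
      apply H; trivial; apply IH; now split.
    - destruct HJ as [HL HJ].
      destruct (Hcl (term_code t) 0 0 0) as ((_ & _ & _ & _ & H) & _); trivial.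
      apply H; trivial; apply IH; now split. }
  assert (Hform : forall A, small_form L N A -> entry c (pair 1 (form_code A))).
  { induction A as [i| |A IH|A IHA B IHB|t A IH]; intros [HJ Hle];
      apply pair_le_inv in Hle as [_ Hle].
    - destruct (Hcl i 0 0 0) as (_ & (H & _) & _); trivial.
    - destruct (Hcl 0 0 0 0) as (_ & (_ & H & _) & _); trivial.
    - destruct (Hcl 0 0 (form_code A) 0) as (_ & (_ & _ & H & _) & _); trivial.
      apply H, IH; now split.
    - apply pair_le_inv in Hle as [HA HB]; destruct HJ as [HJ1 HJ2].
      destruct (Hcl 0 0 (form_code A) (form_code B)) as (_ & (_ & _ & _ & H & _) & _);
        trivial.
      apply H; [apply IHA|apply IHB]; now split.
    - apply pair_le_inv in Hle as [Ht HA]; destruct HJ as [HJ1 HJ2].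
      destruct (Hcl (term_code t) 0 (form_code A) 0) as (_ & (_ & _ & _ & _ & H) & _);
        trivial.
      apply H; [apply Hterm|apply IH]; now split. }
  split.
  - destruct (Hcl 0 0 0 0) as (_ & _ & (H & _) & _); trivial.
  - intros A HA.
    destruct (Hcl 0 0 (form_code A) 0) as (_ & _ & (_ & H & _) & _); trivial;
      [apply HA|]. now apply H, Hform.
  - intros A B HA HB.
    destruct (Hcl 0 0 (form_code A) (form_code B)) as (_ & _ & (_ & _ & H) & _); trivial;
      [apply HA|apply HB|]. now apply H; apply Hform.
  - intros s t A Hs Ht HA.
    destruct (Hcl (term_code s) (term_code t) (form_code A) 0) as (_ & _ & _ & (H & _));
      trivial; [apply Hs|apply Ht|apply HA|].
    apply H; auto.
  - intros s t A Hs Ht HA.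
    destruct (Hcl (term_code s) (term_code t) (form_code A) 0)
      as (_ & _ & _ & (_ & H & _)); trivial; [apply Hs|apply Ht|apply HA|].
    apply H; auto.
  - intros s t A B Hs Ht HA HB.
    destruct (Hcl (term_code s) (term_code t) (form_code A) (form_code B))
      as (_ & _ & _ & (_ & _ & H & _)); trivial; [apply Hs|apply Ht|apply HA|apply HB|].
    apply H; auto.
  - intros t A HL Ht HA.
    destruct (Hcl (term_code t) 0 (form_code A) 0) as (_ & _ & _ & (_ & _ & _ & H & _));
      trivial; [apply Ht|apply HA|].
    apply H; auto.
  - intros t HL Ht.
    destruct (Hcl (term_code t) 0 0 0) as (_ & _ & _ & (_ & _ & _ & _ & H & _));
      trivial; [apply Ht|].
    apply H; auto.
  - intros t A HL Ht HA.
    destruct (Hcl (term_code t) 0 (form_code A) 0)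
      as (_ & _ & _ & (_ & _ & _ & _ & _ & H & _)); trivial; [apply Ht|apply HA|].
    apply H; auto.
  - intros t A HL Ht HA.
    destruct (Hcl (term_code t) 0 (form_code A) 0)
      as (_ & _ & _ & (_ & _ & _ & _ & _ & _ & H & _)); trivial; [apply Ht|apply HA|].
    apply H; auto.
  - intros t A HL Ht HA.
    destruct (Hcl (term_code t) 0 (form_code A) 0)
      as (_ & _ & _ & (_ & _ & _ & _ & _ & _ & _ & H)); trivial; [apply Ht|apply HA|].
    apply H; auto.
Qed.

Lemma form_code_le_offset A : CS A -> form_code A <= offset.
Proof.
  intros HA%CS_spec; unfold offset.
  clear CS_spec; induction lCS as [|B l IH]; [destruct HA|destruct HA as [->|HA]].
  - cbn; lia.
  - change (form_code A <= 6 + (form_code B + list_sum (map form_code l))).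
    specialize (IH HA); lia.
Qed.

(** An accepted certificate is a local model of CS, and its extension to all formulas validates
    every theorem. *)
Lemma provable_decision F : JLform L F -> provable L CS F -> decision (form_code F).
Proof.
  intros HF HP c _ Hc.
  apply (provable_local_model L (form_code F + offset)
    (fun A => entry c (pair 2 (form_code A)))) with CS; trivial.
  - unfold offset; lia.
  - now apply accepted_local_model.
  - intros A HA; split.
    + split; [now apply CS_form|]. pose proof (form_code_le_offset A HA); lia.
    + destruct Hc as [_ Hc]. rewrite Forall_forall in Hc. now apply Hc, CS_spec.
  - split; trivial; lia.
Qed.

(** A valuation satisfying CS and the axioms with codes below [R] yields an accepted certificate,
    hence satisfies [F]; so [F] follows propositionally from finitely many theorems. *)
Lemma decision_provable F : JLform L F -> decision (form_code F) -> provable L CS F.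
Proof.
  intros HF HD. set (n := form_code F) in *.
  set (R := S (tower 12 (box n))).
  destruct (bounded_forms_listable (axiom L) R) as (l & Hl).
  apply provable_of_tautology with (lCS ++ l); trivial.
  { intros A [HA|HA]%in_app_iff.
    - apply CS_spec in HA; split; [auto|now apply pr_ian].
    - apply Hl in HA as [_ HA]; split; [apply HA|now apply pr_axiom]. }
  intros v Hv.
  destruct (certificate_exists R (real_certificate L v)) as (c & Hc & Hcv).
  assert (Hbox : n + offset < box n).
  { apply Nat.lt_succ_r. unfold term_bound.
    etransitivity; [apply le_level|apply le_pair_l]. }
  assert (Hcode : forall A, form_code A <= n + offset ->
    entry c (pair 2 (form_code A)) <-> truth v A = true).
  { intros A HA. rewrite Hcv; [apply real_truth|].
    assert (6 <= offset) by (unfold offset; lia).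
    unfold R; bound. }
  apply Hcode; [fold n; lia|]. apply HD; [exact Hc|split].
  - intros m Hm.
    assert (Hm1 : lft m <= m /\ rgt m <= m)
      by (apply pair_le_inv; now rewrite pair_lft_rgt).
    assert (Hm2 : lft (rgt m) <= rgt m /\ rgt (rgt m) <= rgt m)
      by (apply pair_le_inv; now rewrite pair_lft_rgt).
    assert (Hm3 : lft (rgt (rgt m)) <= rgt (rgt m) /\ rgt (rgt (rgt m)) <= rgt (rgt m))
      by (apply pair_le_inv; now rewrite pair_lft_rgt).
    assert (6 <= box n) by (unfold offset in Hbox; lia).
    apply locally_closed_ext with (real_certificate L v) (box n); trivial; try lia.
    apply real_closed with (box n); trivial; try lia.
    intros A HAc HA; apply Hv, in_app_iff; right; apply Hl; now split.
  - apply Forall_forall; intros A HA. apply Hcode.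
    + apply CS_spec, form_code_le_offset in HA; lia.
    + apply Hv, in_app_iff; now left.
Qed.

End Procedure.

Lemma JLform_cprefix L cs A : JLform L A -> JLform L (cprefix cs A).
Proof. intros HA; induction cs; cbn; auto. Qed.

Lemma provable_decidable L CS : constant_specification L CS -> finite_set CS ->
  decidable_on (JLform L) (provable L CS).
Proof.
  intros hCS [l Hl].
  assert (HCS : forall A, CS A -> JLform L A).
  { intros A HA. destruct (cs_shape _ _ hCS A HA) as (cs & B & _ & [HB _] & ->).
    now apply JLform_cprefix. }
  destruct (recursive_decides _ (recursive_decision L l)) as [p Hp].
  exists p; intros F HF.
  assert (Heq : decision L l (form_code F) <-> provable L CS F).
  { split; [apply (decision_provable L CS l Hl HCS F HF)
           |apply (provable_decision L CS l Hl HCS F HF)]. }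
  rewrite <- Heq. apply Hp.
Qed.

Theorem theorem3p6 (L : logic) (CS : form -> Prop)
    (hCS : constant_specification L CS) (hfin : finite_set CS) :
  (forall F : form, JLform L F -> tableaux_terminate L CS F) /\
  decidable_on (JLform L) (provable L CS).
Proof.
  split.
  - intros F _; now apply tableaux_always_terminate.
  - now apply provable_decidable.
Qed.
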